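(* Let $n\ge 2$ be an integer, let $\mathcal{N}_n$ be the abstract simplicial complex of disconnected graphs on the vertex set $\{1,\ldots,n\}$, and let $\mathscr{V}=\mathscr{V}_n$ be the discrete vector field on $\mathcal{N}_n$ obtained by the staged construction described in the context (first pairing via the edge $(1,2)$, then successively via the vertices $3,4,\ldots,n$). Then $\mathscr{V}$ is a gradient vector field on $\mathcal{N}_n$; that is, $\mathscr{V}$ is a discrete vector field admitting no non-trivial closed $\mathscr{V}$-path.
   Context: Graphs. A graph of order $n$ is a simple, undirected, labelled graph on the vertex set $\{1,\ldots,n\}$; it is identified with its edge set $E(G)$, a set of 2-subsets of $\{1,\ldots,n\}$. The edge joining $i$ and $j$ is written $(i,j)=(j,i)$. If $(i,j)\notin E(G)$, then $G+(i,j)$ is the graph of order $n$ with edge set $E(G)\cup\{(i,j)\}$. The complex. An abstract simplicial complex is a finite nonempty collection of finite sets closed under taking subsets (the empty set is included as a simplex); the dimension of a simplex $\sigma$ is $|\sigma|-1$. $\mathcal{N}_n$ is the complex whose simplices are the (edge sets of) disconnected graphs of order $n$. Discrete vector fields. A discrete vector field on a complex $\mathcal{K}$ is a collection $\mathscr{W}$ of ordered pairs $(\alpha,\beta)$ of simplices of $\mathcal{K}$ with $\alpha\subsetneq\beta$ and $\dim\beta=\dim\alpha+1$, such that each simplex of $\mathcal{K}$ is in at most one pair. A simplex is unpaired in $\mathscr{W}$ if it is in no pair of $\mathscr{W}$. A $\mathscr{W}$-path is a sequence of simplices $\alpha_0^{(d)},\beta_0^{(d+1)},\alpha_1^{(d)},\beta_1^{(d+1)},\ldots,\alpha_k^{(d)},\beta_k^{(d+1)},\alpha_{k+1}^{(d)}$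 (superscripts denote dimension) such that for each $i\in\{0,\ldots,k\}$, $(\alpha_i,\beta_i)\in\mathscr{W}$ and $\beta_i\supsetneq\alpha_{i+1}\neq\alpha_i$. It is a non-trivial closed path if $k\ge 0$ and $\alpha_{k+1}=\alpha_0$. A gradient vector field is a discrete vector field $\mathscr{W}$ that admits no non-trivial closed $\mathscr{W}$-path. Construction of $\mathscr{V}$. Put $$\mathscr{V}_2:=\mathscr{V}_{12}:=\{(G,G+(1,2)) : G\in\mathcal{N}_n,\ (1,2)\notin E(G),\ G+(1,2)\in\mathcal{N}_n\}.$$ For $i=3,4,\ldots,n$ in increasing order, $\mathscr{V}_i$ is obtained from $\mathscr{V}_{i-1}$ by adding all pairs $(G,G+(j,i))$ with $1\le j<i$, $(j,i)\notin E(G)$, such that $G$ and $G+(j,i)$ both belong to $\mathcal{N}_n$ and are both unpaired in $\mathscr{V}_{i-1}$ (for a given $G$ unpaired in $\mathscr{V}_{i-1}$ there is at most one such $j$). Finally $\mathscr{V}:=\mathscr{V}_n$. *)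

(* Defs.v *)
From HB Require Import structures.
From mathcomp Require Import all_boot all_order all_algebra.

Set Implicit Arguments.
Unset Strict Implicit.
Unset Printing Implicit Defensive.

Import GRing.Theory.

Section Complexes.

Variable T : finType.
Implicit Types (s t : {set T}) (K : {set {set T}}) (W : {set {set T} * {set T}}).

Definition simplicial_complex K : Prop :=
  K != set0 /\ (forall s t : {set T}, s \in K -> t \subset s -> t \in K).

(* Integer-valued, so that the empty simplex has dimension -1. *)
Definition dim s : int := (#|s|%:Z - 1)%R.

Definition in_pair s (p : {set T} * {set T}) : bool := (s == p.1) || (s == p.2).

Definition unpaired K W : {set {set T}} :=
  [set s in K | [forall p in W, ~~ in_pair s p]].

Definition discrete_vector_field K W : Prop :=
  (forall a b : {set T}, (a, b) \in W ->
     [/\ a \in K, b \in K, a \proper b & dim b = (dim a + 1)%R])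
  /\ (forall s p q, s \in K -> p \in W -> q \in W ->
        in_pair s p -> in_pair s q -> p = q).

(* The path a 0, b 0, ..., a k, b k, a k.+1; the values of a beyond k.+1 and
   of b beyond k are irrelevant. *)
Definition vpath K W (d : int) (k : nat) (a b : nat -> {set T}) : Prop :=
  [/\ forall i, i <= k.+1 -> a i \in K /\ dim (a i) = d,
      forall i, i <= k -> b i \in K /\ dim (b i) = (d + 1)%R
    & forall i, i <= k ->
        [/\ (a i, b i) \in W, a i.+1 \proper b i & a i.+1 <> a i]].

(* Every vpath contains at least one pair, so a closed one is non-trivial. *)
Definition nontrivial_closed_vpath K W d k a b : Prop :=
  vpath K W d k a b /\ a k.+1 = a 0.

Definition gradient_vector_field K W : Prop :=
  discrete_vector_field K W
  /\ ~ (exists d k a b, nontrivial_closed_vpath K W d k a b).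

End Complexes.

Section DisconnectedGraphs.

Variable n : nat.
Implicit Types (G : {set {set 'I_n}}) (i j : 'I_n).

(* The vertices 1, ..., n are the labels of the elements of 'I_n. *)
Definition label i : nat := i.+1.

Definition is_graph G : bool := [forall e in G, #|e| == 2].

Definition edge i j : {set 'I_n} := [set i; j].

Definition adj G : rel 'I_n := fun i j => edge i j \in G.

Definition connected_graph G : bool := [forall i, forall j, connect (adj G) i j].

Definition add_edge G i j : {set {set 'I_n}} := edge i j |: G.

Definition disconnected_complex : {set {set {set 'I_n}}} :=
  [set G | is_graph G && ~~ connected_graph G].

(* The pairs (G, G + (j, i)) with both members in S. *)
Definition edge_pairs (S : {set {set {set 'I_n}}}) j i :
    {set {set {set 'I_n}} * {set {set 'I_n}}} :=
  [set p | [&& p.1 \in S, edge j i \notin p.1,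
               p.2 == add_edge p.1 j i & p.2 \in S]].

Definition V12 : {set {set {set 'I_n}} * {set {set 'I_n}}} :=
  \bigcup_(i | label i == 2) \bigcup_(j | label j == 1)
    edge_pairs disconnected_complex j i.

Definition add_vertex_pairs (m : nat)
    (W : {set {set {set 'I_n}} * {set {set 'I_n}}}) :=
  W :|: \bigcup_(i | label i == m) \bigcup_(j | label j < label i)
          edge_pairs (unpaired disconnected_complex W) j i.

(* V_stage m is V_m for 2 <= m <= n; the values at 0 and 1 are junk. *)
Fixpoint V_stage (m : nat) : {set {set {set 'I_n}} * {set {set 'I_n}}} :=
  match m with
  | 0 | 1 => set0
  | 2 => V12
  | (_.+2 as m').+1 => add_vertex_pairs m'.+1 (V_stage m')
  end.

Definition V_field := V_stage n.

Lemma disconnected_complexP : 2 <= n -> simplicial_complex disconnected_complex.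
Proof.
move=> n2; split.
  apply/set0Pn; exists set0; rewrite inE; apply/andP; split.
    by apply/forall_inP => e; rewrite inE.
  apply/forallPn; exists (Ordinal (ltnW n2)); apply/forallPn.
  exists (Ordinal n2); apply/negP => /connectP[[|x p] /=].
    by move=> _ /(congr1 val).
  by rewrite /adj inE.
move=> G H; rewrite !inE => /andP[/forall_inP gG cG] /subsetP HG.
apply/andP; split; first by apply/forall_inP => e /HG/gG.
apply: contra cG => /forallP cH; apply/forallP => i; apply/forallP => j.
move/forallP: (cH i) => /(_ j); apply: connect_sub => x y xy.
by apply: connect1; apply: HG.
Qed.

End DisconnectedGraphs.

(* Main.v *)
Require Import Defs.
From mathcomp Require Import all_boot all_order all_algebra.
From mathcomp Require Import zify.

(** Write U_m for the simplices unpaired after stage m.  For m >= 2 the graphs G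
    in U_m are such that, once the edges inside {1,...,m} are deleted, every
    component contains exactly one of the vertices 1,...,m; conversely, keeping
    the edges of G inside {1,...,m} and changing the others so that this still
    holds does not leave U_m.  The vertex m+1 thus has a well-defined root j <= m,
    and the edge (j,m+1) is the only one through which stage m+1 can pair G; this
    makes the field a matching.

    Acyclicity follows formally.  In a closed path take a pair of least stage m,
    adding the edge e.  All simplices of the path are in U_(m-1).  The edge e must
    be removed later, giving a_(l+1) = b_l - e with both sides in U_(m-1); then
    (a_(l+1), b_l) is itself a pair of stage m, so a_(l+1) = a_l, which is
    excluded. *)

Set Implicit Arguments.
Unset Strict Implicit.
Unset Printing Implicit Defensive.

(** * Connectivity through edges not inside the first [m] vertices *)

Lemma connect_invariant (T : finType) (e : rel T) (P : T -> Prop) x y :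
  (forall u v, P u -> e u v -> P v) -> connect e x y -> P x -> P y.
Proof.
move=> Pe /connectP[p]; elim: p x => [|z p IHp] x /=; first by move=> _ ->.
by case/andP=> xz pth ly Px; apply: (IHp z) => //; apply: Pe xz.
Qed.

Section Stages.

Variable n : nat.
Implicit Types (G H s : {set {set 'I_n}}) (i j r u v x y : 'I_n) (m : nat).

Lemma edgeC i j : edge i j = edge j i.
Proof. exact: setUC. Qed.

Lemma edge_eq u v x y :
  edge u v = edge x y -> (u = x /\ v = y) \/ (u = y /\ v = x).
Proof.
move=> E.
have := set21 u v; have := set22 u v; rewrite -/(edge u v) E !inE.
have := set21 x y; have := set22 x y; rewrite -/(edge x y) -E !inE.
by do 4!case/orP=> /eqP ?; subst; auto.
Qed.

Lemma adj_sym G : symmetric (adj G).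
Proof. by move=> x y; rewrite /adj edgeC. Qed.

(* Vertices are indexed from 0: the [m] first ones are those with [x < m]. *)
Definition outer_adj m G : rel 'I_n :=
  fun x y => adj G x y && ((m <= x) || (m <= y)).

Lemma outer_adj_sym m G : symmetric (outer_adj m G).
Proof. by move=> x y; rewrite /outer_adj adj_sym orbC. Qed.

Lemma outer_connect_sym m G : connect_sym (outer_adj m G).
Proof. exact/sym_connect_sym/outer_adj_sym. Qed.

Lemma outer_connectS m G H : G \subset H ->
  subrel (connect (outer_adj m G)) (connect (outer_adj m H)).
Proof.
move=> /subsetP GH; apply: connect_sub => x y /andP[xy mxy].
by apply: connect1; rewrite /outer_adj mxy andbT; apply: GH.
Qed.

Definition rooted m G : Prop :=
  (forall x, exists2 r : 'I_n, r < m & connect (outer_adj m G) r x)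
  /\ (forall r r' : 'I_n, r < m -> r' < m -> connect (outer_adj m G) r r' -> r = r').

Lemma root_unique m G r r' x : rooted m G -> r < m -> r' < m ->
  connect (outer_adj m G) r x -> connect (outer_adj m G) r' x -> r = r'.
Proof.
move=> [_ inj] rm r'm rx r'x; apply: inj => //.
by apply: connect_trans rx _; rewrite outer_connect_sym.
Qed.

Lemma eq_rooted m G H :
  connect (outer_adj m G) =2 connect (outer_adj m H) ->
  rooted m G -> rooted m H.
Proof.
move=> E [cov inj]; split=> [x|r r' rm r'm].
  by have [r rm rx] := cov x; exists r; rewrite -?E.
by rewrite -E; apply: inj.
Qed.

Lemma outer_connect_add m G u v :
  connect (outer_adj m G) u v ->
  connect (outer_adj m (add_edge G u v)) =2 connect (outer_adj m G).
Proof.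
move=> uv x y; apply/idP/idP; last exact/outer_connectS/subsetUr.
apply: connect_sub => a b /andP[]; rewrite /adj !inE => /orP[/eqP E|abG] mab.
  by case/edge_eq: E => -[-> ->]; rewrite // outer_connect_sym.
by apply: connect1; rewrite /outer_adj mab andbT.
Qed.

Lemma rooted_add m G u v : connect (outer_adj m G) u v ->
  rooted m G -> rooted m (add_edge G u v).
Proof. by move=> uv; apply: eq_rooted => x y; rewrite outer_connect_add. Qed.

(** * The stages of the construction and their unpaired simplices *)

Definition unpaired_after m := unpaired (disconnected_complex n) (V_stage n m).

Lemma is_graph_sub G H : H \subset G -> is_graph G -> is_graph H.
Proof.
by move=> /subsetP HG /forall_inP gG; apply/forall_inP => e /HG/gG.
Qed.

Lemma is_graph_add G i j : i != j -> is_graph G -> is_graph (add_edge G i j).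
Proof.
move=> ij /forall_inP gG; apply/forall_inP => e; rewrite !inE.
by case/orP=> [/eqP->|/gG//]; rewrite cards2 ij.
Qed.

(** The special first stage is an instance of the general step applied to the empty field: below
    label 2 the only label is 1, and everything is still unpaired. *)
Lemma V_stageS m : 0 < m ->
  V_stage n m.+1 = add_vertex_pairs m.+1 (V_stage n m).
Proof.
case: m => [//|[|m]] // _; rewrite /= /V12 /add_vertex_pairs set0U.
have -> : unpaired (disconnected_complex n) set0 = disconnected_complex n.
  apply/setP => G; rewrite inE.
  suff -> : [forall p in set0, ~~ in_pair G p] by rewrite andbT.
  by apply/forall_inP => p; rewrite inE.
apply: eq_bigr => i /eqP i2; apply: eq_bigl => j.
by rewrite i2 /label; case: (nat_of_ord j).
Qed.

Lemma edge_pairsP (S : {set {set {set 'I_n}}}) j i p :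
  reflect [/\ p.1 \in S, edge j i \notin p.1, p.2 = add_edge p.1 j i & p.2 \in S]
          (p \in edge_pairs S j i).
Proof.
rewrite inE; apply: (iffP and4P) => -[? ? E ?]; split=> //; first exact/eqP.
by rewrite E.
Qed.

(** The vertex of index [m] carries the label [m.+1], so it is the one treated at stage [m.+1]. *)
Lemma V_stageSP m p : 0 < m ->
  reflect (p \in V_stage n m \/ exists i j : 'I_n,
             [/\ val i = m, j < m & p \in edge_pairs (unpaired_after m) j i])
          (p \in V_stage n m.+1).
Proof.
move=> m0; rewrite V_stageS // inE; apply: (iffP orP) => -[pV|]; try by left.
  case/bigcupP=> i /eqP[im] /bigcupP[j]; rewrite /label ltnS im => jm pE.
  by right; exists i, j.
case=> i [j [im jm pE]]; right; apply/bigcupP; exists i; first by rewrite /label im.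
by apply/bigcupP; exists j; rewrite // /label ltnS im.
Qed.

Lemma V_stage_mono m m' : m <= m' -> V_stage n m \subset V_stage n m'.
Proof.
elim: m' => [|m' IH]; first by rewrite leqn0 => /eqP->.
rewrite leq_eqVlt => /orP[/eqP->//|/IH mm'].
apply: subset_trans mm' _; case: m' {IH} => [|m']; first exact: sub0set.
by rewrite (@V_stageS m'.+1) // subsetUl.
Qed.

Lemma unpairedP m G :
  reflect (G \in disconnected_complex n /\
           forall p, p \in V_stage n m -> ~~ in_pair G p)
          (G \in unpaired_after m).
Proof.
rewrite [G \in unpaired_after m]inE; apply: (iffP andP) => -[GN] => [/forall_inP|] H; split=> //.
exact/forall_inP.
Qed.

(** A new pair containing [G] has as partner either [G] plus an edge or [G] minus an edge; the two
    clauses rule out these partners. *)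
Lemma unpaired_afterSP m G : 0 < m ->
  reflect (G \in unpaired_after m /\
           forall i j : 'I_n, val i = m -> j < m ->
             (edge j i \notin G -> add_edge G j i \notin unpaired_after m) /\
             (edge j i \in G -> G :\ edge j i \notin unpaired_after m))
          (G \in unpaired_after m.+1).
Proof.
move=> m0; apply: (iffP (unpairedP _ _)) => [[GN GV]|[GU GE]].
  have GU : G \in unpaired_after m.
    apply/unpairedP; split=> // p pV; apply: GV.
    by apply/V_stageSP => //; left.
  split=> // i j im jm; split=> jiG; apply/negP => HU.
    have /GV : (G, add_edge G j i) \in V_stage n m.+1.
      apply/V_stageSP => //; right; exists i, j; split=> //.
      exact/edge_pairsP.
    by rewrite /in_pair eqxx.
  have /GV : (G :\ edge j i, G) \in V_stage n m.+1.
    apply/V_stageSP => //; right; exists i, j; split=> //.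
    by apply/edge_pairsP; split; rewrite //= /add_edge ?setD1K // !inE eqxx.
  by rewrite /in_pair eqxx orbT.
have [GN GV] := unpairedP _ _ GU; split=> // p /V_stageSP[//|/GV//|].
case=> i [j [im jm /edge_pairsP[p1 jip E p2]]].
have [G1 G2] := GE i j im jm.
apply/negP => /orP[] /eqP EG; subst G; first by rewrite -E p2 in G1; have := G1 jip.
move: G2; rewrite E setU1K // p1 => /(_ _)/negP; apply=> //.
exact: setU11.
Qed.

Lemma unpaired_after1 : unpaired_after 1 = disconnected_complex n.
Proof.
apply/setP => G; apply/unpairedP/idP => [[]//|GN]; split=> // p.
by rewrite inE.
Qed.

Lemma unpaired_is_graph m G : G \in unpaired_after m -> is_graph G.
Proof. by case/unpairedP; rewrite inE => /andP[]. Qed.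

(** * The invariant describing unpaired graphs *)

Definition agree_below m G H : Prop :=
  forall x y, x < m -> y < m -> adj G x y = adj H x y.

(** The closure half makes the induction run: adding or deleting an edge at the next vertex leaves
    the edges inside the first [m] vertices alone, so only rootedness has to be checked. *)
Definition stage_invariant m : Prop :=
  (forall G, G \in unpaired_after m -> rooted m G) /\
  (forall G H, G \in unpaired_after m -> is_graph H -> agree_below m G H ->
     rooted m H -> H \in unpaired_after m).

Lemma connected_from G u : (forall x, connect (adj G) u x) -> connected_graph G.
Proof.
move=> ux; apply/forallP => x; apply/forallP => y.
by apply: connect_trans (ux y); rewrite (sym_connect_sym (@adj_sym G)).
Qed.

(** Before stage 2 nothing is paired. A graph left over by it lacks the edge [o w] and becomes
    connected when this edge is added, so it has two components, one around [o] and one around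
    [w]. *)
Lemma stage_invariant2 : 2 <= n -> stage_invariant 2.
Proof.
move=> n2; pose o := Ordinal (ltnW n2); pose w := Ordinal n2.
have below2 x : x < 2 -> x = o \/ x = w.
  by case: x => [[|[|x]] xn] // _; [left|right]; apply: val_inj.
have ow : o != w by [].
have full_connect G : rooted 2 G -> connected_graph (add_edge G o w).
  move=> [cov _]; apply: (@connected_from _ o) => x.
  have [r r2 rx] := cov x.
  have rx' : connect (adj (add_edge G o w)) r x.
    apply: connect_sub rx => a b /andP[ab _]; apply: connect1.
    by rewrite /adj !inE; apply/orP; right.
  case: (below2 r r2) rx' => -> // wx; apply: connect_trans wx.
  by apply: connect1; rewrite /adj !inE eqxx.
have step G : edge o w \notin G -> is_graph G -> adj G =2 outer_adj 2 G.
  move=> owG /forall_inP gG x y; rewrite /outer_adj.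
  case xy: (adj G x y) => //=; apply/esym; rewrite (leqNgt 2 x) (leqNgt 2 y) -negb_and.
  apply/negP => /andP[/below2 x2 /below2 y2].
  have xney : x != y.
    by have := gG _ xy; rewrite cards2; case: (x != y).
  move: xy xney; rewrite /adj.
  case: x2 => ->; case: y2 => ->; rewrite ?eqxx //.
    by rewrite (negPf owG).
  by rewrite edgeC (negPf owG).
(* A disconnected graph containing this edge stays disconnected without it, and is thus paired with
   its deletion. *)
have noedge G : G \in unpaired_after 2 -> edge o w \notin G.
  move=> GU; apply/negP => owG.
  have [GU1 /(_ w o erefl isT)[_ /(_ owG)]] := unpaired_afterSP _ (ltn0Sn 0) GU.
  rewrite unpaired_after1 in GU1 *; move/negP; apply.
  have [_] := disconnected_complexP n2; apply; [exact: GU1 | exact: subD1set].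
split=> [G GU|G H GU gH agr rH].
  have owG := noedge G GU; have gG := unpaired_is_graph GU.
  have [GU1 /(_ w o erefl isT)[/(_ owG) + _]] := unpaired_afterSP _ (ltn0Sn 0) GU.
  rewrite unpaired_after1 in GU1 *; move: GU1; rewrite !inE gG /=.
  rewrite is_graph_add //= negbK => Gdis Gcon.
  have E := eq_connect (step G owG gG).
  have nconn : ~~ connect (adj G) o w.
    apply: contra Gdis => cow; apply: (@connected_from _ o) => x.
    move/forallP/(_ o)/forallP/(_ x): Gcon; apply: connect_sub => a b.
    rewrite /adj !inE => /orP[/eqP/edge_eq[][-> ->]//|]; last exact: connect1.
    by rewrite (sym_connect_sym (@adj_sym G)).
  split=> [x|r r' /below2 r2 /below2 r'2].
    move/forallP/(_ o)/forallP/(_ x): Gcon.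
    pose P z := exists2 r : 'I_n, r < 2 & connect (outer_adj 2 G) r z.
    move=> ox; apply: (@connect_invariant _ _ P _ _ _ ox); last by exists o.
    move=> u v [r r2 ru]; rewrite /adj !inE => /orP[/eqP/edge_eq[][_ ->]|uv].
    - by exists w.
    - by exists o.
    - exists r => //; apply: connect_trans ru (connect1 _); by rewrite -step.
  rewrite -E.
  case: r2 => ->; case: r'2 => -> //; first by rewrite (negPf nconn).
  by rewrite (sym_connect_sym (@adj_sym G)) (negPf nconn).
have owH : edge o w \notin H.
  have := agr o w isT isT; rewrite /adj => <-; exact: noedge.
apply/unpaired_afterSP => //; rewrite unpaired_after1; split.
  rewrite inE gH; apply/negP => /forallP/(_ o)/forallP/(_ w).
  rewrite (eq_connect (step H owH gH)) => ow'.
  by have /eqP := rH.2 o w isT isT ow'; rewrite (negPf ow).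
move=> i j i1 j1.
have -> : i = w by apply: val_inj.
have -> : j = o by case: j j1 => [[|k] kn] // _; apply: val_inj.
split=> [_|]; last by rewrite (negPf owH).
by rewrite inE full_connect // andbF.
Qed.

(** Raising the level discards the edges from [i] to lower vertices, and by hypothesis [edge j i] is
    the only one. *)
Lemma outer_adj_step m G i j : val i = m -> j < m ->
  (forall x, x < m -> adj G x i -> x = j) -> is_graph G ->
  forall x y, outer_adj m G x y ->
    [\/ outer_adj m.+1 G x y, x = j /\ y = i | x = i /\ y = j].
Proof.
move=> im jm only gG x y /andP[xy mxy].
have {}im : nat_of_ord i = m := im.
have xney : x != y by have /forall_inP/(_ _ xy) := gG; rewrite cards2; case: (x != y).
rewrite /outer_adj xy /=.
case: (ltnP m x) => mx /=; first by constructor 1.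
case: (ltnP m y) => my /=; first by constructor 1.
have [xm|xm] := ltnP x m; last first.
  have Ex : x = i by apply: ord_inj; lia.
  constructor 3; split=> //; apply: only; last by rewrite adj_sym -Ex.
  rewrite ltn_neqAle my andbT; apply: contra xney => /eqP ym.
  by apply/eqP/ord_inj; rewrite Ex im.
have Ey : y = i by apply: ord_inj; lia.
by constructor 2; split=> //; apply: only; rewrite // -Ey.
Qed.

Lemma outer_adjSW m G : subrel (connect (outer_adj m.+1 G)) (connect (outer_adj m G)).
Proof.
apply: connect_sub => x y /andP[xy mxy]; apply: connect1; rewrite /outer_adj xy /=.
by case/orP: mxy => /ltnW->; rewrite ?orbT.
Qed.

(** An unpaired graph must contain the edge from [i] to its root [j], as its only edge from [i] to a
    lower vertex and as a bridge for outer connectivity. Level [m.+1] ignores this edge, so one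
    component splits in two and [i] becomes a new root. *)
Lemma stage_invariantS m : 2 <= m -> m < n ->
  stage_invariant m -> stage_invariant m.+1.
Proof.
move=> m2 mn [Uroot Uclosed]; have m0 : 0 < m by apply: ltnW.
pose i := Ordinal mn.
have edge_conn G r : r < m -> edge r i \in G -> connect (outer_adj m G) r i.
  by move=> rm riG; apply: connect1; rewrite /outer_adj /adj riG leqnn orbT.
have del_agree G j : agree_below m G (G :\ edge j i).
  move=> x y xm ym; rewrite /adj !inE.
  case: eqP => //= /edge_eq[][? ?]; subst; by rewrite ltnn in xm ym.
have add_agree G j : agree_below m G (add_edge G j i).
  move=> x y xm ym; rewrite /adj !inE.
  case: eqP => //= /edge_eq[][? ?]; subst; by rewrite ltnn in xm ym.
have struct G : G \in unpaired_after m.+1 -> exists j : 'I_n,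
    [/\ j < m, edge j i \in G, forall x, x < m -> adj G x i -> x = j
      & ~ rooted m (G :\ edge j i)].
  move=> /unpaired_afterSP-/(_ m0)[GU GE].
  have rG := Uroot G GU; have gG := unpaired_is_graph GU.
  have [j jm ji] := rG.1 i; exists j.
  have jne : j != i by apply: contraTneq jm => ->; rewrite ltnn.
  have [add del] := GE i j erefl jm.
  have jiG : edge j i \in G.
    (* Joining [i] to its own root changes no component, so the result would be unpaired too and
       would pair with [G]. *)
    apply/negPn/negP => /[dup] jiG /add/negP; apply; apply: (Uclosed G) => //.
    - exact: is_graph_add.
    - exact: rooted_add.
  split=> // [x xm xi|rD].
    by apply: root_unique rG xm jm (edge_conn _ _ xm xi) ji.
  have/negP := del jiG; apply; apply: (Uclosed G) => //.
  exact: is_graph_sub (subD1set _ _) gG.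
split=> [G GU1|G H GU1 gH agr rH].
  have [j [jm jiG only nrD]] := struct G GU1.
  have [GU _] := unpaired_afterSP _ m0 GU1.
  have rG := Uroot G GU; have gG := unpaired_is_graph GU.
  have stepG := @outer_adj_step m _ i j erefl jm only gG.
  have subD : subrel (connect (outer_adj m.+1 G))
                     (connect (outer_adj m (G :\ edge j i))).
    apply: connect_sub => x y /andP[xy mxy]; apply: connect1.
    rewrite /outer_adj /adj !inE [_ \in G]xy andbT; apply/andP; split; last first.
      by case/orP: mxy => /ltnW->; rewrite ?orbT.
    apply/negP => /eqP/edge_eq[][? ?]; subst; move: mxy => /=; lia.
  (* A connection avoiding [edge j i] would make that edge redundant, and deleting it would keep the
     graph rooted. *)
  have sep r : r < m -> ~ connect (outer_adj m.+1 G) r i.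
    move=> rm ri; have Er : r = j.
      exact: root_unique rG rm jm (outer_adjSW ri) (edge_conn _ _ jm jiG).
    subst r; apply: nrD; apply: eq_rooted rG => x y.
    by rewrite -(outer_connect_add (subD _ _ ri)) /add_edge setD1K.
  split=> [x|r r'].
    have [r rm rx] := rG.1 x.
    (* Whenever the walk crosses the discarded edge, it restarts from the root [i] or [j]. *)
    pose P z := exists2 r : 'I_n, r < m.+1 & connect (outer_adj m.+1 G) r z.
    apply: (@connect_invariant _ _ P _ _ _ rx); last first.
      by exists r => //; apply: ltnW.
    move=> u v [s sm su] /stepG[uv|[_ ->]|[_ ->]].
    - by exists s => //; apply: connect_trans su (connect1 uv).
    - by exists i => /=.
    - by exists j => //; apply: ltnW.
  rewrite !ltnS => rm r'm rr'.
  have [rlt|rge] := ltnP r m; have [r'lt|r'ge] := ltnP r' m.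
  - exact: rG.2 (outer_adjSW rr').
  - have Er' : r' = i by apply: ord_inj => /=; lia.
    by case: (sep r); rewrite // -Er'.
  - have Er : r = i by apply: ord_inj => /=; lia.
    by case: (sep r'); rewrite // outer_connect_sym -Er.
  - by apply: ord_inj => /=; lia.
have [j [jm jiG only _]] := struct G GU1.
have [GU _] := unpaired_afterSP _ m0 GU1.
have jS : j < m.+1 by apply: ltnW.
have jiH : edge j i \in H by have := agr j i jS (ltnSn m); rewrite /adj jiG.
have onlyH x : x < m -> adj H x i -> x = j.
  by move=> xm xi; apply: only; rewrite // agr //= ltnS ltnW.
have stepH := @outer_adj_step m _ i j erefl jm onlyH gH.
have sep r : r < m -> ~ connect (outer_adj m.+1 H) r i.
  move=> rm ri; have := rH.2 r i (ltnW rm) (ltnSn m) ri.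
  by move=> Er; move: rm; rewrite Er ltnn.
(* Restoring [edge j i] glues the component of [i] onto that of [j]. *)
have rHm : rooted m H.
  split=> [x|r r' rm r'm].
    have [r rm rx] := rH.1 x; have [rlt|rge] := ltnP r m.
      by exists r => //; apply: outer_adjSW.
    have Er : r = i by apply: ord_inj => /=; lia.
    exists j => //; apply: connect_trans (edge_conn _ _ jm jiH) _.
    by apply: outer_adjSW; rewrite -Er.
  (* Distinct roots are separated at level [m.+1], so only a walk starting at [j] can cross to
     [i]. *)
  pose P z := connect (outer_adj m.+1 H) r z \/
              r = j /\ connect (outer_adj m.+1 H) i z.
  move=> rr'; have [] : P r'.
  - apply: (@connect_invariant _ _ P _ _ _ rr'); last by left.
    move=> u v Pu /stepH[uv|[Eu Ev]|[Eu Ev]].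
    + case: Pu => [ru|[? iu]]; [left | right; split=> //].
        exact: connect_trans ru (connect1 uv).
      exact: connect_trans iu (connect1 uv).
    + rewrite Ev; right; case: Pu => [ru|[Er _]]; split=> //.
      by rewrite Eu in ru; apply: rH.2 ru; apply: ltnW.
    + rewrite Ev; case: Pu => [|[Er _]]; last by left; rewrite Er.
      by rewrite Eu => /(sep r rm).
  - by move=> rr1; apply: rH.2 rr1; apply: ltnW.
  - by case=> _; rewrite outer_connect_sym => /sep-/(_ r'm).
have HU : H \in unpaired_after m.
  apply: (Uclosed G) => // x y xm ym; apply: agr; exact: ltnW.
apply/unpaired_afterSP => //; split=> // i' j' i'm j'm.
have -> : i' = i by apply: val_inj.
have rji := edge_conn H j jm jiH.
(* Adding another edge would give [i] two roots; deleting [edge j i] would leave it none. *)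
split=> j'i; apply/negP => KU.
  have rK := Uroot _ KU.
  have Ej : j' = j.
    apply: root_unique rK j'm jm (edge_conn _ _ j'm (setU11 _ _)) _.
    exact: outer_connectS (subsetUr _ _) _ _ rji.
  by rewrite Ej jiH in j'i.
have Ej : j' = j by apply: onlyH.
subst j'; have [r rm ri] := (Uroot _ KU).1 i.
apply: (sep r rm); apply: connect_sub ri => x y /andP[].
rewrite /adj !inE => /andP[nxy xyH] mxy.
have xyH' : outer_adj m H x y by rewrite /outer_adj /adj xyH.
case: (stepH _ _ xyH') => [|[? ?]|[? ?]]; subst; first exact: connect1.
- by rewrite eqxx in nxy.
- by rewrite edgeC eqxx in nxy.
Qed.

Lemma stage_invariant_all m : 2 <= n -> 2 <= m <= n -> stage_invariant m.
Proof.
move=> n2; elim: m => // m IH /andP[m2 mn].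
have [E|m2'] := eqVneq m 1; first by rewrite E; apply: stage_invariant2.
have m2'' : 2 <= m by lia.
by apply: stage_invariantS => //; apply: IH; rewrite m2'' ltnW.
Qed.

(** * The field is a matching *)

Lemma stage_edge_unique m i j j' p q s : 2 <= n -> 0 < m -> val i = m ->
  j < m -> j' < m -> p \in edge_pairs (unpaired_after m) j i ->
  q \in edge_pairs (unpaired_after m) j' i ->
  in_pair s p -> in_pair s q -> j = j'.
Proof.
move=> n2 m0 im jm j'm pE qE sp sq.
(* The invariant starts at level 2; for [m = 1] both [j] and [j'] have index 0. *)
have [m2|m1] := ltnP 1 m; last by apply: ord_inj => /=; lia.
have mn : m <= n by rewrite -im; exact: ltnW (ltn_ord i).
have [Uroot _] : stage_invariant m by apply: stage_invariant_all; rewrite ?m2.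
(* The added edge shows that [k] is the root of [i] in the upper member. The root of [i] in the
   lower member still reaches [i] in the upper one, hence is also [k]. *)
have root t (k : 'I_n) p' : k < m -> p' \in edge_pairs (unpaired_after m) k i ->
    in_pair t p' -> rooted m t /\ connect (outer_adj m t) k i.
  move=> km /edge_pairsP[p1 kip E p2] tp'.
  have ki : connect (outer_adj m p'.2) k i.
    by apply: connect1; rewrite /outer_adj /adj E setU11 im leqnn orbT.
  case/orP: tp' => /eqP->; last by split=> //; apply: Uroot.
  have r1 := Uroot _ p1; split=> //; have [r rm ri] := r1.1 i.
  suff -> : k = r by [].
  apply: root_unique (Uroot _ p2) km rm ki _.
  by move: ri; apply: outer_connectS; rewrite E subsetUr.
have [rs js] := root _ _ _ jm pE sp; have [_ j's] := root _ _ _ j'm qE sq.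
exact: root_unique rs jm j'm js j's.
Qed.

Lemma edge_pair_eq (S : {set {set {set 'I_n}}}) j i p s :
  p \in edge_pairs S j i -> in_pair s p ->
  p = (s :\ edge j i, add_edge s j i).
Proof.
case: p => [p1 p2] /edge_pairsP[_ /= jip -> _].
rewrite /in_pair /add_edge /= => /orP[] /eqP->; last by rewrite setU1K // setUA setUid.
by congr (_, _); apply/setP => e; rewrite !inE; case: eqP => // ->; apply/negbTE.
Qed.

Lemma V_stage_matching m p q s : 2 <= n ->
  p \in V_stage n m -> q \in V_stage n m -> in_pair s p -> in_pair s q -> p = q.
Proof.
move=> n2; elim: m p q => [|m IH] p q; first by rewrite inE.
have [->|m0] := posnP m; first by rewrite inE.
(* Members of a newly added pair are unpaired in the earlier field. *)
have clash p' q' i j : p' \in V_stage n m ->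
    q' \in edge_pairs (unpaired_after m) j i -> in_pair s p' -> ~ in_pair s q'.
  move=> pV /edge_pairsP[q1 _ _ q2] sp /orP[] /eqP E; subst s.
    by case/unpairedP: q1 => _ /(_ _ pV)/negP.
  by case/unpairedP: q2 => _ /(_ _ pV)/negP.
move=> /V_stageSP-/(_ m0)[pV|[i [j [im jm pE]]]]
  /V_stageSP-/(_ m0)[qV|[i' [j' [i'm j'm qE]]]] sp sq.
- exact: IH sp sq.
- by case: (clash _ _ _ _ pV qE sp).
- by case: (clash _ _ _ _ qV pE sq).
have Ei : i' = i by apply: val_inj; rewrite i'm.
subst i'; have Ej := stage_edge_unique n2 m0 im jm j'm pE qE sp sq.
by subst j'; rewrite (edge_pair_eq pE sp) (edge_pair_eq qE sq).
Qed.

Lemma V_stage_facet m p : p \in V_stage n m ->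
  [/\ p.1 \in disconnected_complex n, p.2 \in disconnected_complex n
    & exists2 e, e \notin p.1 & p.2 = e |: p.1].
Proof.
elim: m => [|m IH]; first by rewrite inE.
have [->|m0] := posnP m; first by rewrite inE.
case/V_stageSP=> // -[i [j [_ _ /edge_pairsP[/unpairedP[p1 _] jip E /unpairedP[p2 _]]]]].
by split=> //; exists (edge j i).
Qed.

End Stages.

(** * Absence of closed paths *)

Theorem mainTheorem1 (n : nat) (hn : 2 <= n) :
  gradient_vector_field (disconnected_complex n) (V_field n).
Proof.
split.
  split=> [a b /V_stage_facet[/= aN bN [e ea E]]|s p q _].
    split=> //; rewrite E; first by rewrite properE subsetUr subUset sub1set (negPf ea).
    by rewrite /Defs.dim cardsU1 ea PoszD; lia.
  exact: V_stage_matching.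
case=> d [k [a [b [[aK bK ab] aclosed]]]].
pose Q m := has (fun i => (a i, b i) \in V_stage n m) (iota 0 k.+1).
have exQ : exists m, Q m.
  exists n; apply/hasP; exists 0; first by rewrite mem_iota.
  by case: (ab 0 (leq0n k)).
case: (ex_minnP exQ) => -[|m] /hasP[i0]; first by move=> _; rewrite inE.
rewrite mem_iota add0n ltnS => /andP[_ i0k] p0 minm.
have [m0|m0] := posnP m; first by move: p0; rewrite m0 inE.
have late i : i <= k -> (a i, b i) \notin V_stage n m.
  move=> ik; apply/negP => pV; have := minm m; rewrite ltnn; move=> H.
  by apply: notF; apply: H; apply/hasP; exists i; rewrite // mem_iota ltnS.
have [pN|[i [j [im jm /edge_pairsP[/= a0U jia0 E0 _]]]]] := V_stageSP _ m0 p0.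
  by move: (late i0 i0k); rewrite pN.
have mn : m < n by rewrite -im; exact: ltn_ord.
(* By the matching property, an earlier pair containing [s] would be the path's own pair, which is
   not that early. *)
have unp l s : l <= k -> s \in disconnected_complex n -> in_pair s (a l, b l) ->
    s \in unpaired_after n m.
  move=> lk sN sp; apply/unpairedP; split=> // p pV; apply/negP => sp'.
  have [pab _ _] := ab l lk; have pn := subsetP (V_stage_mono n (ltnW mn)) _ pV.
  by move: (late l lk); rewrite (V_stage_matching hn pab pn sp sp') pV.
have aU l : l <= k.+1 -> a l \in unpaired_after n m.
  rewrite leq_eqVlt => /orP[/eqP->|lk].
    (* The last simplex starts no pair of the path, but it equals [a 0]. *)
    by rewrite aclosed; apply: (@unp 0) => //; [case: (aK 0)|rewrite /in_pair eqxx].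
  by apply: (@unp l) => //; [case: (aK l (ltnW lk))|rewrite /in_pair eqxx].
set e := edge j i in jia0 E0.
have sub l : l <= k -> e \in a l -> e \in b l.
  move=> lk; have [/V_stage_facet[/= _ _ [f _ ->]] _ _] := ab l lk.
  by move=> el; rewrite inE el orbT.
have keep l : l <= k -> e \in b l -> e \in a l.+1.
  move=> lk eb; apply/negPn/negP => ea; have [pab apb ne] := ab l lk.
  have Eb : b l = e |: a l.+1.
    apply/esym/eqP; rewrite eqEcard subUset sub1set eb proper_sub //=.
    have [_ dimb] := bK l lk; have [_ dima] := aK l.+1 lk.
    have [->] : Posz #|b l| = Posz #|a l.+1|.+1 by move: dimb dima; rewrite /Defs.dim; lia.
    by rewrite cardsU1 ea add1n.
  have pV : (a l.+1, b l) \in V_stage n m.+1.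
    apply/V_stageSP => //; right; exists i, j; split=> //; apply/edge_pairsP.
    split=> //=; first exact: aU.
    by apply: (@unp l) => //; [case: (bK l lk)|rewrite /in_pair eqxx orbT].
  have pn := subsetP (V_stage_mono n mn) _ pV.
  have bin x : in_pair (b l) (x, b l) by rewrite /in_pair eqxx orbT.
  by have [] := V_stage_matching hn pn pab (bin _) (bin _).
have grow l l' : l <= l' -> l' <= k.+1 -> e \in a l -> e \in a l'.
  elim: l' => [|l' IH]; first by rewrite leqn0 => /eqP->.
  rewrite leq_eqVlt => /orP[/eqP->//|ll'] lk ea.
  by apply: keep => //; apply: sub => //; apply: IH => //; apply: ltnW.
have eb0 : e \in b i0 by rewrite E0 setU11.
(* From [b i0] on, [e] is never lost: it reaches [a k.+1], which is [a 0], and then [a i0], which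
   lacks it. *)
have := grow i0.+1 k.+1 i0k (leqnn _) (keep _ i0k eb0).
rewrite aclosed => /(grow 0 i0 (leq0n _) (leqW i0k)).
by rewrite (negPf jia0).
Qed.
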